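(* Let $(X,G)$ be an expansive $G$-system and let $\{F_n\}$ be a Følner sequence of $G$ such that $$e_G\in F_1\subseteq F_2\subseteq\cdots,\quad \lim_{n\to\infty}\frac{|F_n|}{\log n}=\infty,\quad \lim_{n\to\infty}\frac{|F_{n+1}|}{|F_n|}=1,\quad G=\bigcup_{n\in\mathbb N}F_n.$$ Then $(X,G)$ is hereditarily uniformly lowerable along $\{F_n\}$. That is, for every nonempty compact subset $E\subseteq X$ and every $0\le h\le h_{\mathrm{top}}(E,\{F_n\})$, there exists a nonempty compact subset $K_h\subseteq E$ such that $h_{\mathrm{top}}(K_h,\{F_n\})=h$ and $K_h$ has at most one limit point.
   Context: A $G$-system $(X,G)$ is a compact metric space $(X,d)$ with a countably infinite discrete amenable group $G$ (identity $e_G$) acting continuously on $X$ by homeomorphisms. It is expansive if there is $r>0$ such that $\sup_{g\in G}d(gx,gy)\ge r$ for all $x\ne y$ in $X$. A Følner sequence is a sequence $\{F_n\}$ of nonempty finite subsets of $G$ with $|F_n\triangle sF_n|/|F_n|\to0$ for every $s\in G$. For a finite cover $\mathcal U$ and finite $F\subseteq G$, $\mathcal U_F=\bigvee_{g\in F}g^{-1}\mathcal U$; $N(\mathcal U,K)$ is the minimal cardinality of a subfamily of $\mathcal U$ whose union contains $K$. For $K\subseteq X$, $h_{\mathrm{top}}(K,\{F_n\})=\sup_{\mathcal U}\limsup_n\frac1{|F_n|}\log N(\mathcal U_{F_n},K)$ over finite open covers $\mathcal U$ of $X$. *)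

(* Defs.v *)
From HB Require Import structures.
From mathcomp Require Import all_boot all_order all_algebra finmap.
From mathcomp Require Import all_classical all_reals all_analysis.

Set Implicit Arguments.
Unset Strict Implicit.
Unset Printing Implicit Defensive.

Import Order.TTheory GRing.Theory Num.Theory.
Import numFieldNormedType.Exports.

Local Open Scope classical_set_scope.
Local Open Scope ring_scope.

(* Sequences of finite subsets F_1, F_2, ... are encoded as functions from nat
   shifted by one: F n stands for F_{n+1}. *)

Definition ltranslate (G : groupType) (s : G) (A : {fset G}) : {fset G} :=
  [fset (s * g)%g | g in A]%fset.

Definition fsymdiff (T : choiceType) (A B : {fset T}) : {fset T} :=
  ((A `\` B) `|` (B `\` A))%fset.

Definition folner (R : realType) (G : groupType) (F : nat -> {fset G}) : Prop :=
  (forall n, F n != fset0) /\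
  forall s : G,
    (#|` fsymdiff (F n) (ltranslate s (F n))|%:R / #|` F n|%:R : R)
      @[n --> \oo] --> (0 : R).

(* For a countable discrete group, amenability is the existence of a Folner
   sequence. *)
Definition amenable (R : realType) (G : groupType) : Prop :=
  exists F : nat -> {fset G}, folner R F.

(* Each map act g is a homeomorphism, with continuous inverse act g^-1. *)
Record gsystem (R : realType) (X : metricType R) (G : groupType)
    (act : G -> X -> X) : Prop := Gsystem {
  gsystem_compact : compact [set: X];
  gsystem_countable : countable [set: G];
  gsystem_infinite : infinite_set [set: G];
  gsystem_amenable : amenable R G;
  gsystem_act1 : forall x, act 1%g x = x;
  gsystem_actM : forall g h x, act (g * h)%g x = act g (act h x);
  gsystem_continuous : forall g, continuous (act g)
}.

Definition expansive (R : realType) (X : metricType R) (G : groupType)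
    (act : G -> X -> X) : Prop :=
  exists2 r : R, 0 < r & forall x y : X, x <> y ->
    (r%:E <= ereal_sup [set (mdist (act g x) (act g y))%:E | g in [set: G]])%E.

Definition finite_open_cover (X : topologicalType) (U : set (set X)) : Prop :=
  [/\ finite_set U, (forall A, U A -> open A) & \bigcup_(A in U) A = [set: X]].

(* U_F, the join of the covers g^{-1} U for g in F: its members are the
   intersections over g in F of sets g^{-1} (c g) with c g in U. *)
Definition cover_join (X : Type) (G : groupType) (act : G -> X -> X)
    (U : set (set X)) (F : {fset G}) : set (set X) :=
  [set \bigcap_(g in [set` F]) (act g @^-1` c g) |
    c in [set c : G -> set X | forall g, g \in F -> U (c g)]].

Definition has_subcover_card (X : Type) (U : set (set X)) (K : set X)
    (n : nat) : Prop :=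
  exists V : set (set X),
    [/\ V `<=` U, (V #= `I_n)%card & K `<=` \bigcup_(A in V) A].

(* N(U, K); the default value 0 is used only if no finite subfamily of U
   covers K. *)
Definition cover_number (X : Type) (U : set (set X)) (K : set X) : nat :=
  xget 0%N [set n | has_subcover_card U K n /\
                    forall m, has_subcover_card U K m -> (n <= m)%N].

Definition htop (R : realType) (X : metricType R) (G : groupType)
    (act : G -> X -> X) (F : nat -> {fset G}) (K : set X) : \bar R :=
  ereal_sup
    [set limn_esup (fun n =>
        (ln ((cover_number (cover_join act U (F n)) K)%:R : R)
          / #|` F n|%:R)%:E)
    | U in [set U : set (set X) | finite_open_cover U]].

Definition hereditarily_uniformly_lowerable (R : realType) (X : metricType R)
    (G : groupType) (act : G -> X -> X) (F : nat -> {fset G}) : Prop :=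
  forall E : set X, E !=set0 -> compact E ->
  forall h : \bar R, (0 <= h)%E -> (h <= htop act F E)%E ->
  exists K : set X, [/\ K !=set0, compact K, K `<=` E,
    htop act F K = h & is_subset1 (limit_point K)].

(* Main.v *)
Require Import Defs.
From HB Require Import structures.
From mathcomp Require Import all_boot all_order all_algebra finmap.
From mathcomp Require Import all_classical all_reals all_analysis.
From mathcomp Require Import lra zify.

(* Fix e with 2e below the expansivity constant and count finite subsets that
   are (F_n, e)-separated, i.e. whose points are pairwise at distance at least e
   under some g in F_n. By expansiveness and compactness points at distance lam
   are pushed 2e apart by some F_m, so passing from scale lam to scale e only
   costs a factor exp(o(|F_n|)) by the Folner property; thus htop K is the
   exponential growth rate of (F_n, e)-separated subsets of K, for every K.
   Likewise, as |F_{n+1}|/|F_n| -> 1, passing from F_{n+1} to F_n costs a factor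
   exp(o(|F_n|)).

   By compactness some x0 in E has all its neighbourhoods in E of full entropy.
   Given a < h close to h and M, look at a tiny neighbourhood of x0 in E, whose
   points are F_M-indistinguishable from x0, and let n >= M be the first level
   at which it contains exp(a|F_n|) separated points; T is such a set of points. By
   minimality T has at most exp(a|F_m|) separated points at each level m with
   M <= m < n, and hence |T| <= exp(a|F_n| + o(|F_n|)). Iterating with M growing
   fast gives finite sets T_k converging to x0, and K is their union with x0: at
   level n only one T_k contributes exponentially, the earlier ones contribute
   at most n points in total and the later ones look like x0; since
   log n = o(|F_n|), this gives htop K = h. *)

Set Implicit Arguments.
Unset Strict Implicit.
Unset Printing Implicit Defensive.

Import Order.TTheory GRing.Theory Num.Theory.
Import numFieldNormedType.Exports.

Local Open Scope classical_set_scope.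
Local Open Scope ring_scope.

(** * Finite nets and dynamically separated sets *)

Lemma compact_net (R : realType) (X : metricType R) (e : R) :
  compact [set: X] -> 0 < e ->
  exists D : {fset X}, forall x, exists2 c, c \in D & mdist c x < e.
Proof.
move=> /compact_near_coveringP Xc e0.
(* Filter of the properties shared by all large enough finite sets: compactness in near-covering
   form turns a net around each point into one finite net. *)
pose S : set_system {fset X} :=
  [set A | exists D0 : {fset X}, forall D, (D0 `<=` D)%fset -> A D].
have FS : Filter S.
  split; first by exists fset0.
    move=> A B [D1 AD1] [D2 BD2]; exists (D1 `|` D2)%fset => D.
    by rewrite fsubUset => /andP[/AD1 ? /BD2 ?].
  by move=> A B AB [D0 AD0]; exists D0 => D /AD0 /AB.
have /(_ _)[|D0 /(_ D0)] := Xc _ S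
  (fun D x => exists2 c, c \in D & mdist c x < e) FS.
  move=> x _; exists (ball x e, [set D : {fset X} | x \in D]).
    split; first exact: nbhsx_ballx.
    by exists [fset x]%fset => D; rewrite fsub1set.
  move=> [y D] /= [xy xD]; exists x => //.
  by move: xy; rewrite ballEmdist.
by move=> /(_ (fsubset_refl _)) H; exists D0 => x; apply: H.
Qed.

Section Separation.
Context (R : realType) (X : metricType R) (G : groupType) (act : G -> X -> X).
Implicit Types (F D : {fset G}) (T : {fset X}) (S : set X) (e : R).

(** The Bowen distance, the maximum of d(gx, gy) over g in [F], is at least [e]. *)
Definition far F e (x y : X) : bool :=
  has (fun g => e <= mdist (act g x) (act g y)) F.

Definition dynsep F e T : Prop :=
  {in T &, forall x y, x != y -> far F e x y}.

Lemma farP F e x y :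
  reflect (exists2 g, g \in F & e <= mdist (act g x) (act g y)) (far F e x y).
Proof. exact: hasP. Qed.

Lemma farPn F e x y : reflect
  (forall g, g \in F -> mdist (act g x) (act g y) < e) (~~ far F e x y).
Proof.
apply: (iffP hasPn) => H g /H; first by rewrite ltNge.
by rewrite ltNge.
Qed.

Lemma far_sym F e x y : far F e x y = far F e y x.
Proof. by apply: eq_has => g; rewrite metric_sym. Qed.

Lemma farxx F e x : 0 < e -> ~~ far F e x x.
Proof. by move=> e0; apply/farPn => g _; rewrite mdistxx. Qed.

Lemma separated_sub F e T T' :
  (T' `<=` T)%fset -> dynsep F e T -> dynsep F e T'.
Proof. by move=> /fsubsetP TT sT x y /TT xT /TT yT; apply: sT. Qed.

Lemma separated_close F e T :
  dynsep F e T -> {in T &, forall x y, ~~ far F e x y} -> (#|` T| <= 1)%N.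
Proof.
move=> sT cT; have [->|[x xT]] := fset_0Vmem T; first by rewrite cardfs0.
suff -> : T = [fset x]%fset by rewrite cardfs1.
apply/fsetP => y; apply/idP/fset1P => [yT|->//].
by apply/eqP/negPn/negP => /(sT _ _ yT xT); apply/negP/cT.
Qed.

(** A point far from all of a largest separated set could be added to it; the bound [b] guarantees
    that a largest one exists. *)
Lemma separated_maximal F e S (b : nat) : 0 < e ->
  (forall T, [set` T] `<=` S -> dynsep F e T -> (#|` T| <= b)%N) ->
  exists T, [/\ [set` T] `<=` S, dynsep F e T &
    forall y, S y -> exists2 t, t \in T & ~~ far F e t y].
Proof.
move=> e0 bnd.
pose P n := `[< exists T, [/\ [set` T] `<=` S, dynsep F e T & #|` T| = n] >].
have P0 : exists n, P n by exists 0%N; apply/asboolP; exists fset0; split.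
have Pb n : P n -> (n <= b)%N by move=> /asboolP[T [TS sT <-]]; exact: bnd.
have [n /asboolP[T [TS sT Tn]] nmax] := ex_maxnP P0 Pb.
exists T; split=> // y Sy; apply: contrapT => noT.
have allfar t : t \in T -> far F e t y.
  by move=> tT; apply/negPn/negP => nf; apply: noT; exists t.
have yT : y \notin T.
  by apply/negP => /allfar; apply/negP; exact: farxx.
have : P n.+1.
  apply/asboolP; exists (y |` T)%fset; split.
  - by move=> z /=; rewrite in_fset1U => /orP[/eqP ->//|/TS].
  - move=> u v; rewrite !in_fset1U => /orP[/eqP ->|uT] /orP[/eqP ->|vT].
    + by rewrite eqxx.
    + by move=> _; rewrite far_sym; exact: allfar.
    + by move=> _; exact: allfar.
    + exact: sT.
  - by rewrite cardfsU1 yT Tn.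
by move=> /nmax; rewrite ltnn.
Qed.

(* Two points of T with the same (F, e)-neighbour in T' and whose images under
   each g in D lie in the same ball of the net are not (F `|` D, mu)-far, since
   2 e <= mu. *)
Lemma separated_refine (N : {fset X}) F D (e mu : R) T : 0 < e -> e + e <= mu ->
  (forall x, exists2 c, c \in N & mdist c x < e) ->
  dynsep (F `|` D)%fset mu T ->
  exists T', [/\ (T' `<=` T)%fset, dynsep F e T' &
    (#|` T| <= #|` T'| * #|` N| ^ #|` D|)%N].
Proof.
move=> e0 emu net sT.
have [|T' [TT' sT' spanT']] := @separated_maximal F e [set` T] #|` T| e0.
  by move=> T0 T0T _; apply: fsubset_leq_card; apply/fsubsetP.
exists T'; split=> //; first exact/fsubsetP.
have /choice[q qP] : forall x, exists c : N, mdist (val c) x < e.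
  by move=> x; have [c cN cx] := net x; exists [` cN]%fset.
have /choice[p pP] :
    forall y : T, exists t : T', ~~ far F e (val t) (val y).
  move=> y; have [t tT ty] := spanT' (val y) (valP y).
  by exists [` tT]%fset.
pose phi (y : T) := (p y, [ffun g : D => q (act (val g) (val y))]).
have phi_inj : injective phi.
  move=> y z [pyz /ffunP qyz]; apply/val_inj/eqP/negPn/negP => yz.
  have /farP[g] := sT _ _ (valP y) (valP z) yz.
  have near2 w : mdist w (act g (val y)) < e -> mdist w (act g (val z)) < e ->
      mu <= mdist (act g (val y)) (act g (val z)) -> False.
    have := metric_triangle (act g (val y)) w (act g (val z)).
    by rewrite [mdist _ w]metric_sym; lra.
  rewrite in_fsetU => /orP[gF|gD].
    apply: (near2 (act g (val (p y)))); first exact: (farPn _ _ _ _ (pP y)).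
    by rewrite pyz; exact: (farPn _ _ _ _ (pP z)).
  have := qyz [` gD]%fset; rewrite !ffunE/= => qq.
  by apply: (near2 (val (q (act g (val y))))); [|rewrite qq]; exact: qP.
by have := leq_card _ phi_inj; rewrite card_prod card_ffun -!cardfE.
Qed.

(** Refinement down to the empty set of group elements: no two points are far under it, so the
    remaining separated subset has at most one point. *)
Lemma separated_card (N : {fset X}) F (e mu : R) T : 0 < e -> e + e <= mu ->
  (forall x, exists2 c, c \in N & mdist c x < e) ->
  dynsep F mu T -> (#|` T| <= #|` N| ^ #|` F|)%N.
Proof.
move=> e0 emu net sT.
have [|T' [_ sT' le]] := @separated_refine N fset0 F e mu T e0 emu net.
  by rewrite fset0U.
rewrite (leq_trans le)// -[leqRHS]mul1n leq_mul2r; apply/orP; right.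
by apply: (separated_close sT') => x y _ _; apply/farPn => g; rewrite inE.
Qed.

End Separation.

(** * Open covers, Lebesgue numbers and cover numbers *)

Lemma fset_card_II (T : choiceType) (A : {fset T}) :
  ([set` A] #= `I_(#|` A|))%card.
Proof.
have [m Am] := finite_fset A.
by have := card_fset_set Am; rewrite set_fsetK => ->.
Qed.

Lemma open_mdist_lt (R : realType) (X : metricType R) (c : X) (r : R) :
  open [set x | mdist c x < r].
Proof.
rewrite openE => x /= cx; apply/nbhs_ballP; exists (r - mdist c x) => /=.
  by rewrite subr_gt0.
by rewrite ballEmdist => y /= xy; have := metric_triangle c x y; lra.
Qed.

Lemma lebesgue_number (R : realType) (X : metricType R) (U : set (set X)) :
  compact [set: X] -> finite_open_cover U ->
  exists2 lam : R, 0 < lam &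
    forall x, exists2 A, U A & forall y, mdist x y < lam -> A y.
Proof.
move=> /compact_near_coveringP Xc [_ Uo UX].
have /(_ _)[|lam lam0 lamP] := Xc R 0^'+ (fun lam x =>
  exists2 A, U A & forall y, mdist x y < lam -> A y) _.
  move=> x _; have : [set: X] x by [].
  rewrite -UX => -[A UA Ax].
  have /nbhs_ballP[d /= d0 dA] : nbhs x A.
    by apply: open_nbhs_nbhs; split; [exact: Uo|].
  have d20 : 0 < d / 2 by rewrite divr_gt0.
  exists (ball x (d / 2), [set y | y < d / 2]).
    by split; [exact: nbhsx_ballx|exact: nbhs_right_lt].
  move=> [x' lam] /= [xx' lamd]; exists A => // y x'y; apply: dA.
  move: xx'; rewrite !ballEmdist/= => xx'.
  by have := metric_triangle x x' y; lra.
(* Compactness gives the property for all positive reals below [lam]; half of [lam] is one of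
   them. *)
exists (lam / 2); first by rewrite divr_gt0.
move=> x; apply: lamP => //=; last by rewrite divr_gt0.
by rewrite sub0r normrN gtr0_norm ?divr_gt0// ltr_pdivrMr// ltr_pMr// ltr1n.
Qed.

Lemma cover_number_le (X : Type) (U : set (set X)) (K : set X) n :
  has_subcover_card U K n -> (cover_number U K <= n)%N.
Proof.
rewrite /cover_number => Un.
case: xgetP => [m _ [_ /(_ _ Un)]//|].
have exP : exists n, `[< has_subcover_card U K n >] by exists n; apply/asboolP.
have [m /asboolP Um mmin] := ex_minnP exP.
by move=> /(_ m) []; split=> // k Uk; apply: mmin; apply/asboolP.
Qed.

(** The given subcover of size [n] rules out the default value 0, for which the lower bound could
    fail. *)
Lemma cover_number_ge (X : Type) (U : set (set X)) (K : set X) (a n : nat) :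
  has_subcover_card U K n ->
  (forall m, has_subcover_card U K m -> (a <= m)%N) ->
  (a <= cover_number U K)%N.
Proof.
rewrite /cover_number => Un aU.
case: xgetP => [m _ [/aU]//|].
have exP : exists n, `[< has_subcover_card U K n >] by exists n; apply/asboolP.
have [m /asboolP Um mmin] := ex_minnP exP.
by move=> /(_ m) []; split=> // k Uk; apply: mmin; apply/asboolP.
Qed.

(** * Entropy bounds from separated sets *)

Section Entropy.
Context (R : realType) (X : metricType R) (G : groupType) (act : G -> X -> X).
Implicit Types (F : {fset G}) (T : {fset X}) (K : set X) (e : R).

(** Each t in [T] picks the member of the join whose factor at g contains the [lam]-ball about gt,
    hence every y not far from t. Different t may pick the same member, whence only an inequality
    for [n]. *)
Lemma subcover_of_spanning (U : set (set X)) F (lam : R) K T :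
  (forall x, exists2 A, U A & forall y, mdist x y < lam -> A y) ->
  (forall y, K y -> exists2 t, t \in T & ~~ far act F lam t y) ->
  exists2 n, (n <= #|` T|)%N & has_subcover_card (cover_join act U F) K n.
Proof.
move=> lamU spanT.
have /choice[c cP] :
    forall x, exists A, U A /\ forall y, mdist x y < lam -> A y.
  by move=> x; have [A ? ?] := lamU x; exists A.
pose W t := \bigcap_(g in [set` F]) (act g @^-1` c (act g t)).
have [n Wn] : finite_set (W @` [set` T]) by exact: finite_image.
exists n.
  rewrite -card_le_II -(card_le_eql Wn) -(card_le_eqr (fset_card_II T)).
  exact: card_image_le.
exists (W @` [set` T]); split=> //.
  move=> _ [t _ <-]; exists (fun g => c (act g t)) => //= g _.
  by have [] := cP (act g t).
move=> y /spanT[t tT /farPn ty]; exists (W t); first by exists t.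
by move=> g /= gF; apply: (cP (act g t)).2; exact: ty.
Qed.

(** A member of the join cannot contain two separated points, so sending each point of [T] to a
    member of [V] containing it is injective. *)
Lemma separated_le_subcover (U : set (set X)) F e K T n :
  (forall A x y, U A -> A x -> A y -> mdist x y < e) ->
  [set` T] `<=` K -> dynsep act F e T ->
  has_subcover_card (cover_join act U F) K n -> (#|` T| <= n)%N.
Proof.
move=> Ue TK sT [V [VU Vn KV]].
have /choice[f fP] : forall y, exists A, y \in T -> V A /\ A y.
  move=> y; have [yT|yT] := boolP (y \in T); last by exists set0.
  by have [A VA Ay] := KV _ (TK _ yT); exists A.
rewrite -card_le_II -(card_le_eqr Vn) -(card_le_eql (fset_card_II T)).
have finj : {in [set` T] &, injective f}.
  move=> y z; rewrite !inE/= => yT zT fyz.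
  apply/eqP/negPn/negP => /(sT _ _ yT zT).
  move=> /farP[g gF]; rewrite leNgt => /negP; apply.
  have [Vy fy] := fP _ yT; have [_] := fP _ zT; rewrite -fyz.
  have [c cU fc] := VU _ Vy; move: fy; rewrite -fc => fy fz.
  by apply: Ue (cU _ gF) _ _; [exact: fy|exact: fz].
rewrite -(card_le_eql (inj_card_eq finj)); apply: subset_card_le.
by move=> _ [y yT <-]; have [] := fP _ yT.
Qed.

Lemma ball_cover_small e : compact [set: X] -> 0 < e ->
  exists2 U : set (set X), finite_open_cover U &
    forall A x y, U A -> A x -> A y -> mdist x y < e.
Proof.
move=> Xc e0; have e20 : 0 < e / 2 by rewrite divr_gt0.
have [N net] := compact_net Xc e20.
exists ((fun c => [set x | mdist c x < e / 2]) @` [set` N]).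
  split; first exact: finite_image.
    by move=> _ [c _ <-]; exact: open_mdist_lt.
  apply/seteqP; split=> // x _; have [c cN cx] := net x.
  by exists [set x | mdist c x < e / 2] => //; exists c.
move=> _ x y [c _ <-] /= cx cy; have := metric_triangle x c y.
by rewrite [mdist x c]metric_sym; lra.
Qed.

Lemma bounded_separated_maximal F e K : compact [set: X] -> 0 < e ->
  exists T, [/\ [set` T] `<=` K, dynsep act F e T &
    forall y, K y -> exists2 t, t \in T & ~~ far act F e t y].
Proof.
move=> Xc e0; have e20 : 0 < e / 2 by rewrite divr_gt0.
have [N net] := compact_net Xc e20.
apply: (@separated_maximal _ _ _ act F e K (#|` N| ^ #|` F|)%N e0) => T _.
by apply: separated_card e20 _ net; rewrite -splitr.
Qed.

(** A cover by balls of radius [e / 2] witnesses the bound. Since the entropy is an upper limit,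
    large separated sets at arbitrarily late levels suffice. *)
Lemma htop_ge (F : nat -> {fset G}) e K (a : R) :
  compact [set: X] -> 0 < e -> (forall n, F n != fset0) ->
  (forall N, exists n T, [/\ (N <= n)%N, [set` T] `<=` K,
     dynsep act (F n) e T & expR (a * #|` F n|%:R) <= #|` T|%:R]) ->
  (a%:E <= htop act F K)%E.
Proof.
move=> Xc e0 F0 H.
have [U Uc Ue] := ball_cover_small Xc e0.
apply: le_ereal_sup_tmp; exists (limn_esup (fun n =>
  (ln ((cover_number (cover_join act U (F n)) K)%:R : R) / #|` F n|%:R)%:E)).
  by exists U.
apply: le_ereal_inf_tmp => _ [V [N _ NV] <-].
have [n [T [Nn TK sT aT]]] := H N.
apply: le_ereal_sup_tmp; eexists; first by exists n => //; exact: NV.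
have L0 : 0 < #|` F n|%:R :> R by rewrite ltr0n cardfs_gt0.
rewrite lee_fin ler_pdivlMr// -ler_expR.
have Tc : (#|` T| <= cover_number (cover_join act U (F n)) K)%N.
  (* Some finite subcover has to be exhibited, so that the cover number is a true minimum and not
     the default 0. *)
  have [lam lam0 lamU] := lebesgue_number Xc Uc.
  have [T' [_ _ spanT']] := bounded_separated_maximal (F n) K Xc lam0.
  have [m _ Km] := subcover_of_spanning lamU spanT'.
  by apply: (cover_number_ge Km) => k; exact: separated_le_subcover Ue TK sT.
have aC := le_trans aT (_ : _ <= (cover_number (cover_join act U (F n)) K)%:R).
rewrite lnK; first by apply: aC; rewrite ler_nat.
by rewrite posrE; apply: lt_le_trans (expR_gt0 _) (aC _); rewrite ler_nat.
Qed.

(** For a cover with Lebesgue number [lam], a maximal [lam]-separated subset of [K] spans [K] and so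
    yields a subcover of at most its size. As [lam] depends on the cover, all scales enter the
    hypothesis. *)
Lemma htop_le (F : nat -> {fset G}) K (a : R) :
  compact [set: X] -> K !=set0 -> (forall n, F n != fset0) ->
  (forall lam eta : R, 0 < lam -> 0 < eta -> \forall n \near \oo,
     forall T, [set` T] `<=` K -> dynsep act (F n) lam T ->
     #|` T|%:R <= expR ((a + eta) * #|` F n|%:R)) ->
  (htop act F K <= a%:E)%E.
Proof.
move=> Xc [x0 Kx0] F0 H.
apply: ge_ereal_sup => _ [U Uc <-]; apply/lee_addgt0Pr => eta eta0.
have [lam lam0 lamU] := lebesgue_number Xc Uc.
have HV := H lam eta lam0 eta0.
apply: ge_ereal_inf; eexists; first by eexists; [exact: HV|reflexivity].
apply: ge_ereal_sup => _ [n Hn <-].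
have L0 : 0 < #|` F n|%:R :> R by rewrite ltr0n cardfs_gt0.
have [T [TK sT spanT]] := bounded_separated_maximal (F n) K Xc lam0.
have [m mT Km] := subcover_of_spanning lamU spanT.
have [t tT _] := spanT _ Kx0.
rewrite -EFinD lee_fin ler_pdivrMr// -[leRHS]expRK.
have T0 : (0 < #|` T|)%N by rewrite cardfs_gt0; apply/fset0Pn; exists t.
apply: le_trans (_ : _ <= ln #|` T|%:R) _; last first.
  by rewrite ler_ln ?posrE ?expR_gt0 ?ltr0n//; exact: Hn.
have := leq_trans (cover_number_le Km) mT.
(* For cover number 0 the convention [ln 0 = 0] applies; otherwise [ln] is monotone. *)
case: (cover_number _ _) => [|c] cT; first by rewrite ln0// ln_ge0// ler1n.
by rewrite ler_ln ?posrE ?ltr0n// ler_nat.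
Qed.

End Entropy.

(** * Changing the scale and the level at subexponential cost *)

Section Folner.
Context (R : realType) (X : metricType R) (G : groupType) (act : G -> X -> X).
Context (F : nat -> {fset G}).
Context (sysX : gsystem act) (folF : folner R F)
  (F_incr : forall n, (F n `<=` F n.+1)%fset)
  (F_exhaust : \bigcup_n [set` F n] = [set: G])
  (F_ratio : (#|` F n.+1|%:R / #|` F n|%:R : R) @[n --> \oo] --> (1 : R)).

Lemma F_mono m n : (m <= n)%N -> (F m `<=` F n)%fset.
Proof.
move=> /subnK <-; elim: (n - m)%N => [|k IH]; first exact: fsubset_refl.
by rewrite addSn (fsubset_trans IH).
Qed.

Lemma card_F_gt0 n : 0 < #|` F n|%:R :> R.
Proof. by rewrite ltr0n cardfs_gt0; have [] := folF. Qed.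

Lemma nbhs_orbit_close (g : G) (x : X) (rho : R) : 0 < rho ->
  \forall y \near x, mdist (act g x) (act g y) < rho.
Proof.
move=> rho0.
have act_g : {for x, continuous (act g)} by exact: gsystem_continuous.
have /act_g := nbhsx_ballx (act g x) rho rho0.
by rewrite ballEmdist.
Qed.

(** Compactness of the square of X: pairs near the diagonal are closer than [lam], and any other
    pair is moved apart by some g, which lies in all late F_m and by continuity works for nearby
    pairs too. *)
Lemma expansive_uniform (e lam : R) :
  (forall x y, x <> y -> exists g, e < mdist (act g x) (act g y)) -> 0 < lam ->
  exists m, forall x y, lam <= mdist x y -> far act (F m) e x y.
Proof.
move=> expX lam0.
have := compact_setX (gsystem_compact sysX) (gsystem_compact sysX).
move=> /compact_near_coveringP /(_ nat \oo
  (fun m z => mdist z.1 z.2 < lam \/ far act (F m) e z.1 z.2) _)[|m _ /(_ m)].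
  move=> [x y] _ /=.
  have [<-|/eqP/expX[g eg]] := eqVneq x y.
    have l20 : 0 < lam / 2 by rewrite divr_gt0.
    exists (ball x (lam / 2) `*` ball x (lam / 2), setT).
      split; last exact: filterT.
      exists (ball x (lam / 2), ball x (lam / 2)) => //.
      by split; exact: nbhsx_ballx.
    move=> [[u v] m] /= [[] + + _]; rewrite !ballEmdist/= => xu xv; left.
    have := metric_triangle u x v; rewrite [mdist u x]metric_sym.
    by move: xu xv; lra.
  set s := mdist (act g x) (act g y) in eg.
  (* The excess of [s] over [e] is shared equally between the displacements of the two endpoints. *)
  have rho0 : 0 < (s - e) / 2 by rewrite divr_gt0// subr_gt0.
  have [m0 _ gm0] : (\bigcup_n [set` F n]) g by rewrite F_exhaust.
  exists ([set u | mdist (act g x) (act g u) < (s - e) / 2] `*`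
     [set v | mdist (act g y) (act g v) < (s - e) / 2], [set m | (m0 <= m)%N]).
    split; last exact: nbhs_infty_ge.
    exists ([set u | mdist (act g x) (act g u) < (s - e) / 2],
        [set v | mdist (act g y) (act g v) < (s - e) / 2]) => //.
    by split; exact: nbhs_orbit_close.
  move=> [[u v] m] /= [[xu yv] m0m]; right; apply/farP; exists g.
    exact: (fsubsetP (F_mono m0m)).
  have := metric_triangle (act g x) (act g u) (act g y).
  have := metric_triangle (act g u) (act g v) (act g y).
  rewrite [mdist (act g v) _]metric_sym -/s.
  by move: xu yv; lra.
move=> /(_ (leqnn _)) H; exists m => x y; rewrite leNgt => /negP nxy.
by have [||] := H (x, y).
Qed.

(** The union collects the elements of the translates of F_n that leave F_n; each translate
    contributes o(|F_n|) by the Folner property. *)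
Lemma folner_boundary (s : seq G) (eta : R) : 0 < eta -> \forall n \near \oo,
  #|` (\bigcup_(a <- s) (ltranslate a (F n) `\` F n))%fset|%:R
    <= eta * #|` F n|%:R.
Proof.
elim: s eta => [|a s IH] eta eta0.
  by apply: nearW => n; rewrite big_nil cardfs0 mulr_ge0// ltW.
have eta20 : 0 < eta / 2 by rewrite divr_gt0.
have [_ /(_ a) /cvgr0Pnorm_le /(_ _ eta20) Ha] := folF.
apply: filterS2 Ha (IH _ eta20) => n Ha Hs.
rewrite big_cons [in leRHS](splitr eta) mulrDl.
have {}Ha : #|` (ltranslate a (F n) `\` F n)%fset|%:R <= eta / 2 * #|` F n|%:R.
  move: Ha; rewrite ger0_norm ?divr_ge0// ler_pdivrMr ?card_F_gt0//.
  apply: le_trans; rewrite ler_nat; apply: fsubset_leq_card.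
  exact: fsubsetUr.
apply: le_trans (lerD Ha Hs).
by rewrite -natrD ler_nat cardfsU leq_subr.
Qed.

Lemma dynsep_refine_near (D : nat -> {fset G}) (e mu eta : R) :
  0 < e -> e + e <= mu -> 0 < eta ->
  (forall eta : R, 0 < eta ->
    \forall n \near \oo, #|` D n|%:R <= eta * #|` F n|%:R) ->
  \forall n \near \oo, forall T, dynsep act (F n `|` D n)%fset mu T ->
    exists T', [/\ (T' `<=` T)%fset, dynsep act (F n) e T' &
      #|` T|%:R <= #|` T'|%:R * expR (eta * #|` F n|%:R)].
Proof.
move=> e0 emu eta0 Dsmall.
have [N net] := compact_net (gsystem_compact sysX) e0.
(* The successor keeps the argument of [ln] at least 1 even for an empty net, and dividing by
   [c + 1] below avoids the case [c = 0]. *)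
set c : R := ln #|` N|.+1%:R.
have c0 : 0 <= c by rewrite ln_ge0// ler1n.
have c1 : 0 < c + 1 by rewrite ltr_wpDl.
apply: filterS (Dsmall (eta / (c + 1)) (divr_gt0 eta0 c1)) => n Dn T sT.
have [T' [TT' sT' le]] := separated_refine e0 emu net sT.
exists T'; split=> //.
apply: (@le_trans _ _ (#|` T'| * #|` N|.+1 ^ #|` D n|)%N%:R).
  rewrite ler_nat (leq_trans le)// leq_mul//.
  by case: #|` D n| => // k; rewrite leq_exp2r.
rewrite natrM ler_wpM2l// natrX -[X in X ^+ _]lnK ?posrE// -expRM_natl.
rewrite ler_expR (le_trans (ler_wpM2r c0 Dn))// -/c.
rewrite mulrAC ler_wpM2r// mulrAC ler_pdivrMr// ler_wpM2l ?(ltW eta0)//.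
by rewrite lerDl.
Qed.

(** If g in F_n puts two points [lam] apart, some a in F_m puts their images under g at distance
    [e + e]. So ag separates them, and ag lies in F_n or in its small boundary, over which
    refinement is cheap. *)
Lemma dynsep_scale (e lam eta : R) : 0 < e ->
  (forall x y, x <> y -> exists g, e + e < mdist (act g x) (act g y)) ->
  0 < lam -> 0 < eta ->
  \forall n \near \oo, forall T, dynsep act (F n) lam T ->
    exists T', [/\ (T' `<=` T)%fset, dynsep act (F n) e T' &
      #|` T|%:R <= #|` T'|%:R * expR (eta * #|` F n|%:R)].
Proof.
move=> e0 expX lam0 eta0.
have [m mP] := expansive_uniform expX lam0.
have := dynsep_refine_near e0 (lexx (e + e)) eta0 (folner_boundary (F m)).
apply: filterS => n Hn T sT; apply: Hn => x y xT yT /(sT _ _ xT yT) /farP[g gF].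
move=> /mP /farP[a aF]; rewrite -!(gsystem_actM sysX) => ag.
apply/farP; exists (a * g)%g => //; rewrite in_fsetU.
have [//|agF/=] := boolP (_ \in F n).
apply/bigfcupP; exists a; first by rewrite aF.
by rewrite in_fsetD agF/=; apply/imfsetP; exists g.
Qed.

(** The ratio condition makes F_{n+1} minus F_n of size o(|F_n|). Refining over this difference
    lowers the scale to [e / 2], and [dynsep_scale] brings it back to [e]. *)
Lemma dynsep_step (e eta : R) : 0 < e ->
  (forall x y, x <> y -> exists g, e + e < mdist (act g x) (act g y)) ->
  0 < eta ->
  \forall n \near \oo, forall T, dynsep act (F n.+1) e T ->
    exists T', [/\ (T' `<=` T)%fset, dynsep act (F n) e T' &
      #|` T|%:R <= #|` T'|%:R * expR (eta * #|` F n|%:R)].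
Proof.
move=> e0 expX eta0.
have e20 : 0 < e / 2 by rewrite divr_gt0.
have eta20 : 0 < eta / 2 by rewrite divr_gt0.
have e2e : e / 2 + e / 2 <= e by rewrite -splitr.
have Dsmall (eta' : R) : 0 < eta' -> \forall n \near \oo,
    #|` (F n.+1 `\` F n)%fset|%:R <= eta' * #|` F n|%:R.
  move=> eta'0; have /cvgr_dist_le/(_ _ eta'0) := F_ratio.
  apply: filterS => n; rewrite distrC ler_norml => /andP[_].
  rewrite lerBlDr ler_pdivrMr ?card_F_gt0// mulrDl mul1r -lerBlDr.
  by rewrite cardfsDS// natrB// fsubset_leq_card.
have := dynsep_scale e0 expX e20 eta20.
have := dynsep_refine_near e20 e2e eta20 Dsmall.
apply: filterS2 => n Hstep Hscale T sT.
have [|T1 [T1T /Hscale[T2 [T2T1 sT2 T12]] T01]] := Hstep T.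
  by rewrite fsetUDl fsetDv fsetD0 (fsetUidPr _ _ (F_incr n)).
exists T2; split=> //; first exact: fsubset_trans T1T.
rewrite [in leRHS](splitr eta) mulrDl expRD mulrA (le_trans T01)//.
by rewrite ler_wpM2r// expR_ge0.
Qed.

End Folner.

(** * Strictly increasing sequences of levels *)

Section IncreasingNat.
Context (u : nat -> nat) (u_lt : forall k, (u k < u k.+1)%N).
Local Open Scope nat_scope.

Lemma increasing_homo j k : j <= k -> u j <= u k.
Proof.
exact: (homo_leq (leqnn : reflexive leq) leq_trans (fun i => ltnW (u_lt i))).
Qed.

Lemma increasing_ge_id k : k <= u k.
Proof. by elim: k => // k /leq_ltn_trans; apply. Qed.

Lemma increasing_bracket n : u 0 <= n -> exists k, u k <= n < u k.+1.
Proof.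
move=> u0n; have [|i /= ui|k uk kmax] := @ex_maxnP (fun k => u k <= n) n.
- by exists 0.
- exact: leq_trans (increasing_ge_id i) ui.
by exists k; rewrite uk/= ltnNge; apply/negP => /kmax; rewrite ltnn.
Qed.

End IncreasingNat.

(** * Entropy at the fixed scale [e] *)

Section Lowering.
Context (R : realType) (X : metricType R) (G : groupType) (act : G -> X -> X).
Context (F : nat -> {fset G}).
Context (sysX : gsystem act) (folF : folner R F)
  (F_incr : forall n, (F n `<=` F n.+1)%fset)
  (F_exhaust : \bigcup_n [set` F n] = [set: G])
  (F_ratio : (#|` F n.+1|%:R / #|` F n|%:R : R) @[n --> \oo] --> (1 : R))
  (F_log : (#|` F n|%:R / ln (n.+1%:R) : R) @[n --> \oo] --> +oo).
Context (e : R) (e0 : 0 < e)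
  (expX : forall x y, x <> y -> exists g, e + e < mdist (act g x) (act g y)).

(** The logarithmic growth condition lets constant factors and counts linear in n be absorbed into
    exp(o(|F_n|)). *)
Lemma succ_le_expR (eta : R) : 0 < eta ->
  \forall n \near \oo, n.+1%:R <= expR (eta * #|` F n|%:R).
Proof.
move=> eta0; have /cvgry_ge/(_ eta^-1) := F_log.
apply: filterS2 (nbhs_infty_gt 0) => n n0.
rewrite ler_pdivlMr ?ln_gt0 ?ltr1n// mulrC ler_pdivrMr// => lnL.
by rewrite -[leLHS]lnK ?posrE// ler_expR mulrC.
Qed.

Lemma htop_le_separated K (a : R) : K !=set0 ->
  (forall eta : R, 0 < eta -> \forall n \near \oo,
     forall T : {fset X}, [set` T] `<=` K -> dynsep act (F n) e T ->
     #|` T|%:R <= expR ((a + eta) * #|` F n|%:R)) ->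
  (htop act F K <= a%:E)%E.
Proof.
move=> K0 Ka; apply: htop_le => //.
- exact: gsystem_compact sysX.
- by have [] := folF.
move=> lam eta lam0 eta0; have eta20 : 0 < eta / 2 by rewrite divr_gt0.
have := dynsep_scale sysX folF F_incr F_exhaust e0 expX lam0 eta20.
apply: filterS2 (Ka _ eta20) => n Kn scale T TK /scale[T' [T'T sT' le]].
rewrite [in leRHS](splitr eta) addrA mulrDl expRD (le_trans le)//.
rewrite ler_wpM2r ?expR_ge0// Kn// => x xT'; apply: TK.
exact: (fsubsetP T'T).
Qed.

(** With an [e / 2]-net [N], separated sets at level n have at most |N|^|F_n| points. *)
Lemma htop_lty K : K !=set0 -> (htop act F K < +oo)%E.
Proof.
move=> K0; have e20 : 0 < e / 2 by rewrite divr_gt0.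
have [N net] := compact_net (gsystem_compact sysX) e20.
apply: (@le_lt_trans _ _ (ln #|` N|.+1%:R)%:E); last exact: ltry.
apply: htop_le_separated => // eta eta0; apply: nearW => n T _ sT.
have e2e : e / 2 + e / 2 <= e by rewrite -splitr.
rewrite (le_trans (_ : _ <= (#|` N|.+1 ^ #|` F n|)%:R))//.
  rewrite ler_nat (leq_trans (separated_card e20 e2e net sT))//.
  by case: #|` F n| => // k; rewrite leq_exp2r.
rewrite natrX -[X in X ^+ _]lnK ?posrE// -expRM_natl ler_expR mulrC.
by rewrite ler_wpM2r// lerDl ltW.
Qed.

(** Sets with growth rate below [H] at scale [e] form an ideal, the factor 2 of a union being
    subexponential, and [E] is not in it. The sets with small complement in [E] thus form a proper
    filter, and a cluster point of it has no neighbourhood with small trace on [E]. *)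
Lemma entropy_point E (H : R) : E !=set0 -> compact E -> htop act F E = H%:E ->
  exists2 x0, E x0 & forall a del : R, a < H -> 0 < del -> forall N,
    exists n (T : {fset X}), [/\ (N <= n)%N, [set` T] `<=` E `&` ball x0 del,
      dynsep act (F n) e T & expR (a * #|` F n|%:R) <= #|` T|%:R].
Proof.
move=> E0 Ec EH.
pose small S := exists2 a, a < H & \forall n \near \oo, forall T : {fset X},
  [set` T] `<=` S -> dynsep act (F n) e T ->
  #|` T|%:R <= expR (a * #|` F n|%:R).
have small_sub S S' : S `<=` S' -> small S' -> small S.
  move=> SS' [a aH Sa]; exists a => //; apply: filterS Sa => n Sn T TS.
  by apply: Sn; exact: subset_trans SS'.
have small0 : small set0.
  exists (H - 1); first by rewrite ltrBlDr ltrDl.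
  apply: nearW => n T T0 _.
  have -> : T = fset0 by apply/fsetP => x; rewrite in_fset0; apply/negP => /T0.
  by rewrite cardfs0 expR_ge0.
have smallU S S' : small S -> small S' -> small (S `|` S').
  move=> [a aH Sa] [b bH Sb].
  have cH : Num.max a b < H by rewrite gt_max aH.
  pose eta := (H - Num.max a b) / 2.
  have eta0 : 0 < eta by rewrite divr_gt0// subr_gt0.
  exists (Num.max a b + eta); first by rewrite /eta; lra.
  apply: filterS3 (filterI Sa Sb) (succ_le_expR eta0) (nbhs_infty_gt 0).
  move=> n [Sn S'n] n2 n0 T TS sT.
  pose T1 := [fset x in T | x \in S]%fset.
  have T1T : (T1 `<=` T)%fset by exact: fset_sub.
  have c1 : #|` T1|%:R <= expR (Num.max a b * #|` F n|%:R).
    rewrite (le_trans (Sn _ _ (separated_sub T1T sT)))//.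
      by move=> x /=; rewrite !inE => /andP[_]; rewrite inE.
    by rewrite ler_expR ler_wpM2r// le_max lexx.
  have c2 : #|` (T `\` T1)%fset|%:R <= expR (Num.max a b * #|` F n|%:R).
    rewrite (le_trans (S'n _ _ (separated_sub (fsubsetDl _ _) sT)))//.
      move=> x /=; rewrite !inE => /andP[xT1 xT]; have [|//] := TS _ xT.
      by move=> /mem_set xS; move: xT1; rewrite xT xS.
    by rewrite ler_expR ler_wpM2r// le_max lexx orbT.
  rewrite -(cardfsID T1 T) (fsetIidPr T1T) natrD (le_trans (lerD c1 c2))//.
  rewrite -mulr2n -[leLHS]mulr_natr mulrDl expRD ler_wpM2l ?expR_ge0//.
  by rewrite (le_trans _ n2)// ler_nat ltnS.
have notsmallE : ~ small E.
  move=> [a aH Ea]; suff : (H%:E <= a%:E)%E by rewrite lee_fin leNgt aH.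
  rewrite -EH; apply: htop_le_separated => // eta eta0.
  apply: filterS Ea => n En T TE sT; rewrite (le_trans (En T TE sT))//.
  by rewrite ler_expR ler_wpM2r// lerDl ltW.
pose Fl : set_system X := [set A | small (E `\` A)].
have FlF : ProperFilter Fl.
  split; first by rewrite /Fl/= setD0.
  split; first by rewrite /Fl/= setDT.
    by move=> A B EA EB; rewrite /Fl/= setDIr; exact: smallU.
  by move=> A B AB; apply: small_sub; exact: setDS.
have FlE : Fl E by rewrite /Fl/= setDv.
have [x0 [Ex0 clx0]] := Ec Fl FlF FlE.
exists x0 => // a del aH del0 N; apply: contrapT => no.
have : Fl (~` ball x0 del).
  rewrite /Fl/= setDE setCK; exists a => //; exists N => // n /= Nn T TS sT.
  by rewrite leNgt; apply/negP => /ltW lt; apply: no; exists n, T.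
by move=> /clx0 /(_ (nbhsx_ballx x0 _ del0))[x [/=]].
Qed.

Lemma nbhs_orbits_close (s : seq G) (x : X) (rho : R) : 0 < rho ->
  \forall y \near x, forall g, g \in s -> mdist (act g x) (act g y) < rho.
Proof.
move=> rho0; elim: s => [|a s IH]; first exact: nearW.
apply: filterS2 (nbhs_orbit_close sysX a x rho0) IH => y ya ys g.
by rewrite in_cons => /orP[/eqP ->|/ys].
Qed.

(* Stopping at the first level n at which exp (a |F n|) separated points exist
   bounds the number of separated points at all the levels before n. *)
Lemma stopped_separated_set E (H : R) x0 :
  (forall a del : R, a < H -> 0 < del -> forall N,
    exists n (T : {fset X}), [/\ (N <= n)%N, [set` T] `<=` E `&` ball x0 del,
      dynsep act (F n) e T & expR (a * #|` F n|%:R) <= #|` T|%:R]) ->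
  forall (a del : R) M, a < H -> 0 < del -> exists n (T : {fset X}),
    [/\ (M <= n)%N, [set` T] `<=` E `&` ball x0 del,
        (forall x g, x \in T -> g \in F M ->
           mdist (act g x0) (act g x) < e / 2),
        dynsep act (F n) e T /\ expR (a * #|` F n|%:R) <= #|` T|%:R &
        forall m T', (M <= m < n)%N -> (T' `<=` T)%fset ->
          dynsep act (F m) e T' -> #|` T'|%:R <= expR (a * #|` F m|%:R)].
Proof.
move=> Hx0 a del M aH del0; have e20 : 0 < e / 2 by rewrite divr_gt0.
have /nbhs_ballP[d /= d0 dP] : nbhs x0 ([set y | forall g, g \in F M ->
    mdist (act g x0) (act g y) < e / 2] `&` ball x0 del).
  by apply: filterI; [exact: nbhs_orbits_close|exact: nbhsx_ballx].
pose Q n := `[< exists T : {fset X},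
    [/\ (M <= n)%N, [set` T] `<=` E `&` ball x0 d,
      dynsep act (F n) e T & expR (a * #|` F n|%:R) <= #|` T|%:R] >].
have exQ : exists n, Q n.
  by have [n QT] := Hx0 a d aH d0 M; exists n; apply/asboolP.
have [n /asboolP[T [Mn TE sT aT]] nmin] := ex_minnP exQ.
exists n, T; split=> //.
- by move=> x /TE[Ex /dP[]].
- by move=> x g /TE[Ex /dP[+ _]]; exact.
- move=> m T' /andP[Mm mn] T'T sT'; rewrite leNgt; apply/negP => /ltW lt.
  have : Q m.
    apply/asboolP; exists T'; split=> // x xT'; apply: TE.
    exact: (fsubsetP T'T).
  by move=> /nmin; rewrite leqNgt mn.
Qed.

(** * The compact set built from the stopped sets *)

Section StoppedUnion.
Context (x0 : X) (st nn : nat -> nat) (T : nat -> {fset X})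
  (h : R) (h0 : 0 <= h)
  (T_near : forall k x, x \in T k -> mdist x0 x < k.+1%:R^-1)
  (T_close : forall k x g, x \in T k -> g \in F (st k) ->
     mdist (act g x0) (act g x) < e / 2)
  (T_sep : forall k, dynsep act (F (nn k)) e (T k))
  (T_min : forall k m T', (st k <= m < nn k)%N -> (T' `<=` T k)%fset ->
     dynsep act (F m) e T' -> #|` T'|%:R <= expR (h * #|` F m|%:R))
  (st_nn : forall k, (st k <= nn k)%N)
  (st_S : forall k, st k.+1 = (st k + nn k + #|` T k|).+1).

Local Notation K := ([set x0] `|` \bigcup_k [set` T k]).

Let st_lt k : (st k < st k.+1)%N.
Proof. by rewrite st_S ltnS -addnA leq_addr. Qed.

Let st_mono j k : (j <= k)%N -> (st j <= st k)%N.
Proof. exact: increasing_homo. Qed.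

(** This is why the recursion for [st] includes |T_k|: at levels n >= st k the blocks before [k]
    have at most n points in total. *)
Lemma card_initial_union k :
  (#|` (\bigcup_(j <- index_iota 0 k) T j)%fset| <= st k)%N.
Proof.
elim: k => [|k IH]; first by rewrite big_nil cardfs0.
rewrite big_nat_recr//= cardfsU (leq_trans (leq_subr _ _))//.
by rewrite (leq_trans (leq_add IH (leqnn _)))// st_S; lia.
Qed.

(** All late blocks lie within half the distance from [x0] to [y] of [x0], so they miss the ball of
    that radius about [y]; the finitely many points of the early blocks other than [y] can be
    avoided. *)
Lemma stopped_union_isolated y : y <> x0 -> \forall z \near y, K z -> z = y.
Proof.
move=> yx0; have rho0 : 0 < mdist x0 y / 2.
  by rewrite divr_gt0// mdist_gt0; apply/eqP => /esym.
have [k _ kP] := near_infty_natSinv_lt (PosNum rho0).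
pose P := (\bigcup_(j <- index_iota 0 k) T j `\ y)%fset.
have Pc : open (~` [set` P]).
  have := hausdorff_accessible (@metric_hausdorff R X).
  move=> /accessible_finite_set_closed fc; rewrite openC; apply: fc.
  exact: finite_fset.
have Py : (~` [set` P]) y by rewrite /= in_fsetD1 eqxx.
have := nbhsx_ballx y _ rho0; rewrite ballEmdist.
apply: filterS2 (open_nbhs_nbhs (conj Pc Py)).
move=> z Pz /= yz [/= zx0|[j _ /= zj]].
  by exfalso; move: yz; rewrite zx0 metric_sym; have := rho0; lra.
have [jk|kj] := ltnP j k.
  apply/eqP/negPn/negP => zy; apply: Pz; rewrite /= in_fsetD1 zy/=.
  by apply/bigfcupP; exists j => //; rewrite mem_index_iota jk.
exfalso; have := metric_triangle x0 z y; rewrite [mdist z y]metric_sym.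
have : mdist x0 z < mdist x0 y / 2 := lt_trans (T_near zj) (kP _ kj).
by move: yz; lra.
Qed.

Lemma stopped_union_compact : compact K.
Proof.
apply: (@subclosed_compact _ _ [set: X]); last exact: subsetT.
  move=> y cly; have [->|/eqP yx0] := eqVneq y x0; first by left.
  by have [z [Kz /(_ Kz) <-]] := cly _ (stopped_union_isolated yx0).
exact: gsystem_compact sysX.
Qed.

Lemma stopped_union_limit_point : is_subset1 (limit_point K).
Proof.
suff lx0 y : limit_point K y -> y = x0 by move=> y z /lx0 -> /lx0 ->.
move=> ly; apply: contrapT => yx0.
have [z [zy Kz /(_ Kz)/eqP]] := ly _ (stopped_union_isolated yx0).
exact/negP.
Qed.

(** Before level [nn k], minimality applies. From [nn k] on, |T_k| bounds the count, and one step
    down to level [nn k] - 1 makes minimality applicable to it. *)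
Lemma stopped_set_card (eta : R) : 0 < eta -> exists N, forall k n T',
  (N <= k)%N -> (st k <= n)%N -> (T' `<=` T k)%fset -> dynsep act (F n) e T' ->
  #|` T'|%:R <= expR ((h + eta) * #|` F n|%:R).
Proof.
move=> eta0; have [N _ stepN] :=
  dynsep_step sysX folF F_incr F_exhaust F_ratio e0 expX eta0.
exists N => k n T' Nk stkn T'T sT'.
have heta : 0 <= h + eta by rewrite addr_ge0// ltW.
have Lmono m : (m <= n)%N ->
    expR ((h + eta) * #|` F m|%:R) <= expR ((h + eta) * #|` F n|%:R).
  move=> mn; rewrite ler_expR ler_wpM2l// ler_nat fsubset_leq_card//.
  exact: F_mono.
have [nlt|nge] := ltnP n (nn k).
  rewrite (le_trans (T_min _ T'T sT'))// ?stkn//.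
  by rewrite ler_expR ler_wpM2r// lerDl ltW.
apply: (@le_trans _ _ #|` T k|%:R); first by rewrite ler_nat fsubset_leq_card.
(* If stopping was immediate there is no earlier level to use; but then all of T_k is [e / 2]-close
   to [x0] under F_{nn k}, so it has at most one point. *)
have [stn|] := eqVneq (st k) (nn k).
  apply: (@le_trans _ _ 1); last by rewrite -expR0 ler_expR mulr_ge0.
  rewrite lern1; apply: (separated_close (@T_sep k)) => x y xT yT.
  apply/farPn => g; rewrite -stn => gF.
  have := T_close xT gF; have := T_close yT gF.
  have := metric_triangle (act g x) (act g x0) (act g y).
  by rewrite [mdist (act g x) (act g x0)]metric_sym; lra.
rewrite neq_ltn [(nn k < _)%N]ltnNge st_nn orbF => stn.
have nnS : nn k = (nn k).-1.+1 by rewrite prednK//; lia.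
have Np : (N <= (nn k).-1)%N by have := increasing_ge_id st_lt k; lia.
have /= /(_ (T k))[|T1 [T1T sT1 le]] := stepN _ Np; first by rewrite -nnS.
rewrite (le_trans le)// (le_trans _ (Lmono (nn k).-1 _))//; last by lia.
rewrite mulrDl expRD ler_wpM2r ?expR_ge0//.
by apply: (T_min _ T1T sT1); lia.
Qed.

(** For st k <= n < st (k+1) a separated set is split into its points in earlier blocks ([S1]), in
    block [k] ([S2]), and the rest ([S3]), which is indistinguishable from [x0] under F_n because st
    j > n for j > k. *)
Lemma htop_stopped_union_le : (htop act F K <= h%:E)%E.
Proof.
apply: htop_le_separated; first by exists x0; left.
move=> eta eta0; have eta20 : 0 < eta / 2 by rewrite divr_gt0.
have [N NP] := stopped_set_card eta20.
apply: filterS3 (succ_le_expR eta20) (nbhs_infty_gt 0) (nbhs_infty_ge (st N)).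
move=> n nL n0 stNn S SK sS.
have [|k /andP[stkn nst]] := increasing_bracket st_lt (n := n).
  by apply: leq_trans stNn; exact: st_mono.
have Nk : (N <= k)%N.
  by rewrite leqNgt; apply/negP => kN; have := st_mono kN; lia.
pose P := (\bigcup_(j <- index_iota 0 k) T j)%fset.
pose S1 := (S `&` P)%fset; pose S2 := ((S `\` P) `&` T k)%fset.
pose S3 := ((S `\` P) `\` T k)%fset.
have S1n : (#|` S1| <= n)%N.
  rewrite (leq_trans _ stkn)// (leq_trans _ (card_initial_union k))//.
  by rewrite fsubset_leq_card// fsubsetIr.
have S2L : #|` S2|%:R <= expR ((h + eta / 2) * #|` F n|%:R).
  apply: NP Nk stkn (fsubsetIr _ _) _; apply: separated_sub sS.
  exact: fsubset_trans (fsubsetIl _ _) (fsubsetDl _ _).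
have S3close x g : x \in S3 -> g \in F n ->
    mdist (act g x0) (act g x) < e / 2.
  rewrite !in_fsetD => /and3P[xk xP xS] gF.
  have [->|[j _ /= xj]] := SK _ xS; first by rewrite mdistxx divr_gt0.
  have kj : (k < j)%N.
    rewrite ltn_neqAle; apply/andP; split.
      by apply: contraNneq xk => ->.
    rewrite leqNgt; apply: contraNN xP => jk.
    by apply/bigfcupP; exists j => //; rewrite mem_index_iota jk.
  apply: (T_close xj); apply: (fsubsetP (F_mono F_incr _)) gF.
  by have := st_mono kj; lia.
have S31 : (#|` S3| <= 1)%N.
  have sS3 : dynsep act (F n) e S3.
    apply: separated_sub sS.
    exact: fsubset_trans (fsubsetDl _ _) (fsubsetDl _ _).
  apply: (separated_close sS3) => x y xS yS; apply/farPn => g gF.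
  have := S3close _ _ xS gF; have := S3close _ _ yS gF.
  have := metric_triangle (act g x) (act g x0) (act g y).
  by rewrite [mdist (act g x) (act g x0)]metric_sym; lra.
rewrite -(cardfsID P S) -(cardfsID (T k) (S `\` P)%fset) addnCA !natrD.
rewrite [in leRHS](splitr eta) [h + _]addrA mulrDl expRD.
(* The target is B * A with 2 <= n + 1 <= A <= B: [S1] and [S3] have at most n + 1 <= B points
   together and [S2] at most B, and B + B <= B * A. *)
set A := expR (eta / 2 * _) in nL *; set B := expR _ in S2L *.
have AB : A <= B by rewrite ler_expR ler_wpM2r// lerDr.
have A2 : 2 <= A by rewrite (le_trans _ nL)// ler_nat ltnS.
have S13 : #|` S1|%:R + #|` S3|%:R <= B.
  apply: (le_trans _ AB); apply: (le_trans _ nL).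
  by rewrite -natrD ler_nat; move: S1n S31; lia.
apply: le_trans (lerD S2L S13) _.
have B0 : 0 <= B by exact: expR_ge0.
by rewrite -mulr2n -[leLHS]mulr_natr ler_wpM2l.
Qed.

End StoppedUnion.

End Lowering.

(** * Recursive choice of the blocks and the two entropy bounds *)

Theorem theorem3p16 (R : realType) (X : metricType R) (G : groupType)
    (act : G -> X -> X) (F : nat -> {fset G})
    (sysX : gsystem act) (expX : expansive act) (folF : folner R F)
    (F_1 : 1%g \in F 0%N)
    (F_incr : forall n, (F n `<=` F n.+1)%fset)
    (F_log : (#|` F n|%:R / ln (n.+1%:R) : R) @[n --> \oo] --> +oo)
    (F_ratio : (#|` F n.+1|%:R / #|` F n|%:R : R) @[n --> \oo] --> (1 : R))
    (F_exhaust : \bigcup_n [set` F n] = [set: G]) :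
  hereditarily_uniformly_lowerable act F.
Proof.
move=> E E0 Ec h h0 hE.
have [r r0 expr] := expX.
(* Then [e + e] is strictly below [r], so it is exceeded at some g even if the supremum over g is
   not attained. *)
pose e : R := r / 4; have e0 : 0 < e by rewrite divr_gt0.
have expe x y : x <> y -> exists g, e + e < mdist (act g x) (act g y).
  move=> /expr rxy; have : ((e + e)%:E < r%:E)%E by rewrite lte_fin /e; lra.
  move=> /lt_le_trans/(_ rxy)/ereal_sup_gt[_ [g _ <-]].
  by rewrite lte_fin => eg; exists g.
have HEoo := htop_lty sysX folF F_incr F_exhaust e0 expe E0.
have [H EH] : exists H, htop act F E = H%:E.
  have := le_trans h0 hE; move: HEoo; case: (htop act F E) => [H|//|//] _ _.
  by exists H.
rewrite EH in hE; move: hE h0; case: h => [h|//|//]; rewrite !lee_fin => hH h0.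
have [x0 Ex0 x0P] :=
  entropy_point sysX folF F_incr F_exhaust F_log e0 expe E0 Ec EH.
have inv0 k : 0 < k.+1%:R^-1 :> R by rewrite invr_gt0 ltr0n.
(* The rates h - 1/(k+1) stay strictly below [H] even for h = H, and tend to h. *)
have ltH k : h - k.+1%:R^-1 < H.
  by apply: lt_le_trans hH; rewrite ltrBlDr ltrDl.
have block := stopped_separated_set sysX e0 x0P.
(* Blocks are chosen for all pairs of an index and a starting level at once, since the starting
   level [st k] is only known recursively. *)
have /choice[B] (kM : nat * nat) := block _ _ kM.2 (ltH kM.1) (inv0 kM.1).
move=> /choice[T0 BT].
pose st := fix st k :=
  if k is k'.+1 then (st k' + B (k', st k') + #|` T0 (k', st k')|).+1 else 0%N.
pose nn k := B (k, st k); pose T k := T0 (k, st k).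
have st_nn k : (st k <= nn k)%N by have [] := BT (k, st k).
have st_S k : st k.+1 = (st k + nn k + #|` T k|).+1 by [].
have st_lt k : (st k < st k.+1)%N by rewrite st_S ltnS -addnA leq_addr.
have T_E k x : x \in T k -> E x by have [_ TE _ _ _] := BT (k, st k) => /TE[].
have T_near k x : x \in T k -> mdist x0 x < k.+1%:R^-1.
  by have [_ TE _ _ _] := BT (k, st k) => /TE[_]; rewrite ballEmdist.
have T_close k x g : x \in T k -> g \in F (st k) ->
    mdist (act g x0) (act g x) < e / 2.
  by have [_ _ + _ _] := BT (k, st k); apply.
have T_sep k : dynsep act (F (nn k)) e (T k).
  by have [_ _ _ [? _] _] := BT (k, st k).
have T_card k : expR ((h - k.+1%:R^-1) * #|` F (nn k)|%:R) <= #|` T k|%:R.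
  by have [_ _ _ [_ ?] _] := BT (k, st k).
have T_min k m T' : (st k <= m < nn k)%N -> (T' `<=` T k)%fset ->
    dynsep act (F m) e T' -> #|` T'|%:R <= expR (h * #|` F m|%:R).
  have [_ _ _ _ minT] := BT (k, st k) => km T'T sT'.
  rewrite (le_trans (minT _ _ km T'T sT'))// ler_expR ler_wpM2r//.
  by rewrite lerBlDr lerDl ltW.
exists ([set x0] `|` \bigcup_k [set` T k]); split.
- by exists x0; left.
- apply: (stopped_union_compact sysX T_near).
- by move=> x [->//|[k _ /T_E]].
- apply/eqP; rewrite eq_le; apply/andP; split.
    exact: (htop_stopped_union_le sysX folF F_incr F_exhaust F_ratio F_log e0
      expe h0 T_close T_sep T_min st_nn st_S).
  (* For the lower bound, T_k itself is the separated set at level [nn k], with [k] so large that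
     1/(k+1) < eps. *)
  apply/lee_subgt0Pr => eps eps0; rewrite -EFinB.
  apply: (htop_ge (gsystem_compact sysX) e0); first by have [] := folF.
  move=> N; have [k0 _ k0P] := near_infty_natSinv_lt (PosNum eps0).
  pose k := maxn N k0; exists (nn k), (T k); split=> //.
  + apply: (leq_trans (leq_maxl N k0)).
    exact: leq_trans (increasing_ge_id st_lt k) (st_nn k).
  + by move=> x xT; right; exists k.
  + rewrite (le_trans _ (T_card k))// ler_expR ler_wpM2r// lerB//.
    by apply: ltW; apply: k0P; exact: leq_maxr.
- exact: (stopped_union_limit_point T_near).
Qed.
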